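(* The families $\mathrm{FC}$ and $\mathrm{TFC}\setminus\mathrm{VFC}$ are strongly $2^{\mathfrak{c}}$-algebrable (as subsets of the commutative algebra $\mathbb{R}^{\mathbb{R}^2}$ of all functions from $\mathbb{R}^2$ to $\mathbb{R}$ with pointwise operations).
   Context: Notation: $x_n\searrow x$ means that $(x_n)$ is a strictly decreasing sequence of reals converging to $x$; $\mathfrak{c}$ is the cardinality of the continuum. Let $f\colon\mathbb{R}^2\to\mathbb{R}$. $f$ is feebly continuous at $\langle x,y\rangle$ if there exist $x_n\searrow x$ and $y_m\searrow y$ such that $\lim_{n\to\infty}\lim_{m\to\infty}f(x_n,y_m)=f(x,y)$. $f$ is very feebly continuous at $\langle x,y\rangle$ if there exist $x_n\searrow x$ and, for each $n\in\mathbb{N}$, a sequence $y^{(n)}_m\searrow y$ (as $m\to\infty$) such that $\lim_{n\to\infty}\lim_{m\to\infty}f(x_n,y^{(n)}_m)=f(x,y)$. (In both cases the inner limits exist in $\mathbb{R}$ for each $n$, and the outer limit exists.) $f$ is two-feebly continuous at $\langle x,y\rangle$ if there exist $x_n\searrow x$ and $y_n\searrow y$ such that $\lim_{n\to\infty}f(x_n,y_n)=f(x,y)$. $\mathrm{FC}$, $\mathrm{VFC}$, $\mathrm{TFC}$ denote the sets of all functions $f\colon\mathbb{R}^2\to\mathbb{R}$ that are feebly continuous, very feebly continuous, two-feebly continuous, respectively, at every point of $\mathbb{R}^2$. Let $L$ be a commutative linear algebra and $\kappa$ a cardinal. A set $A\subset L$ is strongly $\kappa$-algebrable if $A\cup\{0\}$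 contains a $\kappa$-generated algebra that is isomorphic to a free algebra. Equivalently, there is a set $X\subset L$ of cardinality $\kappa$ (a set of free generators) such that for any $k\in\mathbb{N}$, any nonzero real polynomial $P$ in $k$ variables without constant term, and any distinct $y_1,\dots,y_k\in X$, we have $P(y_1,\dots,y_k)\neq 0$ and $P(y_1,\dots,y_k)\in A$. *)

(* Defs.v *)
From HB Require Import structures.
From mathcomp Require Import all_boot all_order all_algebra.
From mathcomp Require Import boolp classical_sets functions cardinality.
From mathcomp Require Import reals topology normedtype sequences.
(* The notations of mpoly would clash with those of mathcomp-analysis. *)
From mathcomp Require Import -(notations) mpoly.

Set Implicit Arguments.
Unset Strict Implicit.
Unset Printing Implicit Defensive.

Import Order.TTheory GRing.Theory Num.Theory.
Import numFieldNormedType.Exports.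

Local Open Scope classical_set_scope.
Local Open Scope ring_scope.

(* The library equips T -> A with its pointwise ring and R-module structures;
   the instances below only record that they form a commutative R-algebra. *)
Section FunctionAlgebra.
Variables (T : pointedType) (R : nzRingType) (A : comAlgType R).

Let fct_scalerAl (k : R) (f g : T -> A) : k *: (f * g) = (k *: f) * g.
Proof. by apply/funext => t; exact: scalerAl. Qed.

HB.instance Definition _ :=
  GRing.Lmodule_isLalgebra.Build R (T -> A) fct_scalerAl.
HB.instance Definition _ := GRing.Lalgebra_isComAlgebra.Build R (T -> A).

End FunctionAlgebra.

(* A cardinal is given as the cardinality of a set K. Elements of X indexed
   injectively by 'I_k are the distinct y_1, ..., y_k; mmap evaluates the
   polynomial at them, the scalars being sent to L by c |-> c *: 1 (a scalar
   that only matters as a multiple, P having no constant term). *)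
Definition strongly_algebrable (R : comNzRingType) (L : comAlgType R)
    (U : Type) (K : set U) (A : set L) : Prop :=
  exists X : set L, (X #= K)%card /\
    forall (k : nat) (P : mpoly k R) (y : 'I_k -> L),
      P != 0 -> mcoeff mnm0 P = 0 ->
      injective y -> (forall i, X (y i)) ->
      mmap (GRing.in_alg L) y P != 0 /\
      A (mmap (GRing.in_alg L) y P).

Section FeebleContinuity.
Variable R : realType.
Implicit Types (f : R * R -> R) (x y : R).

(* decreasing_seq is strict. *)
Definition decreases_to (u : nat -> R) (x : R) : Prop :=
  decreasing_seq u /\ u n @[n --> \oo] --> x.

(* The sequence g holds the inner limits. *)
Definition feebly_continuous_at f x y : Prop :=
  exists u v : nat -> R, decreases_to u x /\ decreases_to v y /\
    exists g : nat -> R,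
      (forall n, f (u n, v m) @[m --> \oo] --> g n) /\
      g n @[n --> \oo] --> f (x, y).

Definition very_feebly_continuous_at f x y : Prop :=
  exists (u : nat -> R) (v : nat -> nat -> R),
    decreases_to u x /\ (forall n, decreases_to (v n) y) /\
    exists g : nat -> R,
      (forall n, f (u n, v n m) @[m --> \oo] --> g n) /\
      g n @[n --> \oo] --> f (x, y).

Definition two_feebly_continuous_at f x y : Prop :=
  exists u v : nat -> R, decreases_to u x /\ decreases_to v y /\
    f (u n, v n) @[n --> \oo] --> f (x, y).

Definition FC : set (R * R -> R) :=
  [set f | forall x y, feebly_continuous_at f x y].

Definition VFC : set (R * R -> R) :=
  [set f | forall x y, very_feebly_continuous_at f x y].

Definition TFC : set (R * R -> R) :=
  [set f | forall x y, two_feebly_continuous_at f x y].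

End FeebleContinuity.
Arguments FC : clear implicits.
Arguments VFC : clear implicits.
Arguments TFC : clear implicits.
Arguments strongly_algebrable R L {U} K A.

(* Main.v *)
Require Import Defs.
From mathcomp Require Import all_boot all_order all_algebra.
From mathcomp Require Import boolp classical_sets functions cardinality.
From mathcomp Require Import reals topology normedtype sequences.
Import numFieldNormedType.Exports.
Local Open Scope classical_set_scope.
From mathcomp Require Import -(notations) mpoly.
From mathcomp Require Import lra.

Set Implicit Arguments.
Unset Strict Implicit.
Unset Printing Implicit Defensive.

Import Order.TTheory GRing.Theory Num.Theory.
Local Open Scope ring_scope.

(** Why the theorem holds.

    Both families of generators have the form A |-> h_A o sigma, where A runs
    through the subsets of R (so there are 2 ^ c of them).

    The map sigma sends R onto the set S of all functions from a countable set
    to R, and it is invariant under the translations x |-> x + 4^-n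
    (invariant_surjection): sigma only looks at the tail of the base-4
    expansion, and every element of S can be coded into a tail. Hence each
    function that factors through sigma takes its value at x again along
    x + 4^-n, a sequence decreasing strictly to x.

    The functions h_A on S are interpolating: for distinct A_1, ..., A_k and
    any reals r_1, ..., r_k, some s in S has h_{A_i}(s) = r_i for all i
    (trace_function_interpolating). This is the idea of the
    Fichtenholz-Kantorovich-Hausdorff independent families: finitely many sets
    are told apart by finitely many points, and an element s of S consists of
    finitely many points together with a value for each trace that a set can
    leave on them. Since a nonzero polynomial P is nonzero at some (r_i)
    (mpoly_nonvanishing), P(h_{A_1}, ..., h_{A_k}) is not the zero function.

    For FC the generators are (x, y) |-> h_A(sigma x). Everything generated by
    them depends on sigma x only, so it is invariant under x |-> x + 4^-n, and
    both limits are limits of constant sequences.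

    For TFC \ VFC the generators are h_A(sigma x) on the diagonal y = x and 0
    off it. Everything generated by them is invariant under the diagonal
    translations by (4^-n, 4^-n), hence two-feebly continuous. As P has no
    constant term, P of the generators vanishes off the diagonal, while it is
    nonzero at a suitable point (a, a) of it. If x_n > a and y_m decreases to a,
    then y_m < x_n for large m, so every inner limit at (a, a) is 0 and the
    outer limit is not the value there. *)

(** * Values of polynomials in several variables *)

Lemma digits_inj (d n : nat) (a b : 'I_n -> nat) :
  (forall i, a i < d)%N -> (forall i, b i < d)%N ->
  (\sum_i a i * d ^ i = \sum_i b i * d ^ i)%N -> a =1 b.
Proof.
elim: n a b => [|n IHn] a b lt_a_d lt_b_d; first by move=> _ [].
have split_digit (c : 'I_n.+1 -> nat) : (\sum_i c i * d ^ i =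
    (\sum_(i < n) c (lift ord0 i) * d ^ i) * d + c ord0)%N.
  rewrite big_ord_recl expn0 muln1 addnC big_distrl /=; congr (_ + _)%N.
  by apply: eq_bigr => i _; rewrite /bump /= add1n expnSr mulnA.
rewrite !split_digit => eq_ab.
have eq0 : a ord0 = b ord0.
  by have := congr1 (modn^~ d) eq_ab; rewrite /= !modnMDl !modn_small.
have d_gt0 : (0 < d)%N by apply: leq_ltn_trans (lt_a_d ord0).
have eqS := IHn (a \o lift ord0) (b \o lift ord0)
  (fun i => lt_a_d _) (fun i => lt_b_d _) _.
move: eq_ab; rewrite eq0 => /addIn /eqP.
rewrite eqn_pmul2r // => /eqP /eqS eqab i.
by case: (unliftP ord0 i) => [j ->|->] //; exact: eqab.
Qed.

(** Kronecker substitution: with d above all exponents, putting t ^ (d ^ i) for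
    the i-th variable sends distinct monomials to distinct powers of t, which
    leaves a nonzero polynomial in one variable. *)
Lemma mpoly_nonvanishing (F : numDomainType) (k : nat) (P : mpoly k F) :
  P != 0 -> exists v : 'I_k -> F, meval v P != 0.
Proof.
move=> P_neq0.
have [m0 m0_supp] : exists m0, m0 \in msupp P.
  case E : (msupp P) => [|m s]; last by exists m; rewrite inE eqxx.
  by rewrite -msupp_eq0 E in P_neq0.
set d := (\max_(m <- msupp P) \max_(i < k) m i).+1.
have lt_d m i : m \in msupp P -> (m i < d)%N.
  move=> m_supp; rewrite ltnS; apply: leq_trans (leq_bigmax i) _.
  exact: (@leq_bigmax_seq _ _ xpredT (fun m : multinom k => \max_(i < k) m i)).
pose w (m : multinom k) := (\sum_i m i * d ^ i)%N.
pose q : {poly F} := \sum_(m <- msupp P) mcoeff m P *: 'X^(w m).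
have q_eval t : q.[t] = meval (fun i : 'I_k => t ^+ (d ^ i)) P.
  rewrite mevalE horner_sum; apply: eq_bigr => m _.
  rewrite hornerZ hornerXn -prodrXr; congr (_ * _).
  by apply: eq_bigr => i _; rewrite -exprM mulnC.
have q_neq0 : q != 0.
  apply/eqP => /(congr1 (fun p : {poly F} => p`_(w m0))).
  rewrite coef0 coef_sum (bigD1_seq m0) ?msupp_uniq //= big1_seq ?addr0.
    by apply/eqP; rewrite coefZ coefXn eqxx mulr1 -mcoeff_msupp.
  move=> m /andP[neq_m m_supp]; rewrite coefZ coefXn.
  case: eqP; last by rewrite mulr0.
  move=> /digits_inj eq_m; case/eqP: neq_m; apply/mnmP => i; apply/esym.
  by apply: eq_m => j; exact: lt_d.
(* In characteristic 0, more naturals than the degree are too many roots. *)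
pose s := [seq i%:R : F | i <- iota 0 (size q)].
have uniq_s : uniq s.
  by rewrite map_inj_uniq ?iota_uniq //; exact: mulrIn (oner_neq0 F).
have : ~~ all (root q) s.
  apply/negP => /(max_poly_roots q_neq0) /(_ uniq_s).
  by rewrite size_map size_iota ltnn.
rewrite -has_predC => /hasP[t _ /=]; rewrite /root q_eval => nz.
by eexists; exact: nz.
Qed.

Lemma meval_origin (F : comNzRingType) (k : nat) (P : mpoly k F) :
  meval (fun=> 0) P = mcoeff mnm0 P.
Proof.
rewrite mevalE [LHS](eq_bigr (fun m => mcoeff m P * (m == mnm0)%:R)); last first.
  move=> m _; congr (_ * _); case: eqP => [->|/eqP m_neq0].
    by rewrite big1 // => i _; rewrite mnm0E expr0.
  have [i m_i] : exists i, m i != 0%N.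
    apply/existsP; apply: contra_neqT m_neq0 => /existsPn m0.
    by apply/mnmP => i; rewrite mnm0E; apply/eqP; rewrite -[_ == _]negbK.
  by rewrite (bigD1 i) //= expr0n (negPf m_i) mul0r.
have [P0|P0] := boolP (mnm0 \in msupp P).
  rewrite (bigD1_seq mnm0) ?msupp_uniq //= eqxx mulr1 big1 ?addr0 // => m.
  by move/negPf=> ->; rewrite mulr0.
rewrite (memN_msupp_eq0 P0) big1_seq // => m /andP[_ m_supp].
by case: eqP m_supp P0 => [-> ->//|_ _ _]; rewrite mulr0.
Qed.

(** * A translation-invariant surjection *)

Section TailCode.
Variable R : realType.

(** The parity of the (n+1)-st base-4 digit: the numbers built in
    [quaternary_expansion] only have digits 0 and 1, and parity is unchanged
    when a multiple of 4 is added to the floor. *)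
Definition quaternary_digit (n : nat) (x : R) : bool :=
  ~~ (2 %| Num.floor (4 ^+ n.+1 * x))%Z.

(** Bit i of the code is repeated at each of the infinitely many positions n of
    2-adic valuation i; reading it off eventually makes the code independent of
    any initial segment of the expansion. *)
Definition tail_code (x : R) : set nat :=
  [set i | exists N, forall n, (N <= n)%N -> logn 2 n = i ->
     quaternary_digit n x].

Lemma quaternary_digitD (m n : nat) (x : R) : (m <= n)%N ->
  quaternary_digit n (x + 4^-1 ^+ m) = quaternary_digit n x.
Proof.
move=> le_mn; rewrite /quaternary_digit mulrDr.
have -> : 4 ^+ n.+1 * 4^-1 ^+ m = (4 ^+ (n - m).+1)%:~R :> R.
  rewrite rmorphXn /= -[in LHS](subnK le_mn) -addSn exprD -mulrA -exprMn.
  rewrite divff ?pnatr_eq0 //.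
  by rewrite expr1n mulr1.
rewrite floorDrz ?intr_int // intrKfloor; congr (~~ _).
by rewrite rpredDr // exprS dvdz_mulr.
Qed.

Lemma tail_codeD (m : nat) (x : R) : tail_code (x + 4^-1 ^+ m) = tail_code x.
Proof.
apply/seteqP; split=> i [N digitN]; exists (maxn m N) => n;
  rewrite geq_max => /andP[le_mn le_Nn] /(digitN _ le_Nn);
  by rewrite quaternary_digitD.
Qed.

Fixpoint quaternary_prefix (b : nat -> bool) (n : nat) : nat :=
  if n is n'.+1 then (4 * quaternary_prefix b n' + b n')%N else 0%N.

(** The witness is the sum of the b k / 4 ^ (k + 1). Its partial sums s n
    never decrease and s n + 1 / (3 * 4 ^ n) never increases, because a tail of
    1s sums to 1 / (3 * 4 ^ n); thus the remainder after the n-th digit is less than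
    one unit of that digit, which determines the floor. *)
Lemma quaternary_expansion (b : nat -> bool) :
  exists x : R, forall n, quaternary_digit n x = b n.
Proof.
pose N n : R := (quaternary_prefix b n)%:R.
pose s n := N n / 4 ^+ n.
have NS n : N n.+1 = 4 * N n + (b n)%:R by rewrite /N /= natrD natrM.
have pow_gt0 n : 0 < 4 ^+ n :> R by rewrite exprn_gt0.
have b01 n : 0 <= ((b n)%:R : R) <= 1 by case: (b n); rewrite ?ler01 ?lexx.
have ler_s m n : (m <= n)%N -> s m <= s n.
  apply: (@homo_leq _ s (fun x y => x <= y)) => // [x y z|k].
    exact: le_trans.
  rewrite /s NS exprS invfM mulrA ler_pM2r ?invr_gt0 //.
  by have := b01 k; lra.
have ler_t m n : (m <= n)%N -> s n + 3^-1 / 4 ^+ n <= s m + 3^-1 / 4 ^+ m.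
  rewrite -lerN2.
  apply: (@homo_leq _ (fun i => - (s i + 3^-1 / 4 ^+ i))
    (fun x y => x <= y)) => // [x y z|k].
    exact: le_trans.
  rewrite lerN2 /s -!mulrDl NS exprS invfM mulrA ler_pM2r ?invr_gt0 //.
  by have := b01 k; lra.
have s_bounded m n : s m <= s n + 3^-1 / 4 ^+ n.
  have t_gt0 k : 0 < 3^-1 / 4 ^+ k :> R by rewrite divr_gt0 ?invr_gt0 ?ltr0n.
  apply: le_trans (ler_s _ _ (leq_maxl m n)) _.
  by apply: le_trans (ler_t _ _ (leq_maxr m n)); rewrite lerDl ltW.
have sup_s : has_sup (range s).
  split; first by exists (s 0%N), 0%N.
  by exists (s 0%N + 3^-1 / 4 ^+ 0) => _ [m _ <-].
exists (sup (range s)) => n.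
have lo : s n.+1 <= sup (range s) by apply: sup_upper_bound => //; exists n.+1.
have hi : sup (range s) <= s n.+1 + 3^-1 / 4 ^+ n.+1.
  by apply: ge_sup; [case: sup_s | move=> _ [m _ <-]].
have floorE : Num.floor (4 ^+ n.+1 * sup (range s)) =
    (quaternary_prefix b n.+1)%:Z.
  apply: floor_def; rewrite intrD -!pmulrn.
  rewrite mulrC -ler_pdivrMr // lo /= -ltr_pdivlMr //.
  apply: le_lt_trans hi _; rewrite /s -mulrDl ltr_pM2r ?invr_gt0 // ltrD2l.
  by lra.
rewrite /quaternary_digit floorE dvdzE /= dvdn2 oddD oddM /=.
by rewrite negbK oddb.
Qed.

Lemma tail_code_surj (B : set nat) : exists x : R, tail_code x = B.
Proof.
have [x digit_x] := quaternary_expansion (fun n => `[< B (logn 2 n) >]).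
exists x; apply/seteqP; split=> i /=; last first.
  by move=> Bi; exists 0%N => n _ log_n; rewrite digit_x log_n; apply/asboolP.
case=> N digitN; have log_i : logn 2 (2 ^ i * 3 ^ N) = i.
  by rewrite lognM ?expn_gt0 // !lognX logn_prime //= muln1 muln0 addn0.
(* 2 ^ i * 3 ^ N is a position of valuation i beyond N. *)
have := digitN (2 ^ i * 3 ^ N)%N _ log_i; rewrite digit_x log_i => B_i.
apply/asboolP/B_i.
by apply: leq_trans (leq_pmull _ _); rewrite ?expn_gt0 // ltnW // ltn_expl.
Qed.

(** A real is known from the rationals below it, so countably many reals are
    known from a set of naturals. *)
Definition countable_code (C : countType) (g : C -> R) : set nat :=
  [set i | exists c q, i = pickle (c, q) /\ ratr q < g c].

Lemma countable_code_inj (C : countType) : injective (@countable_code C).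
Proof.
suff le_code (g h : C -> R) :
    countable_code g = countable_code h -> forall c, g c <= h c.
  by move=> g h eq_gh; apply/funext => c; apply/le_anti; rewrite !le_code.
move=> eq_gh c; rewrite leNgt; apply/negP => /rat_in_itvoo[q].
rewrite in_itv /= => /andP[lt_hq lt_qg].
have : countable_code g (pickle (c, q)) by exists c, q.
rewrite eq_gh => -[c' [q' [/(pcan_inj pickleK)[<- <-]]]].
by rewrite ltNge ltW.
Qed.

(** [sigma] decodes the tail code; it is surjective since the code of any g is
    the tail code of some real. The default value 0 is taken at reals whose
    tail code codes nothing. *)
Lemma invariant_surjection (C : countType) :
  exists sigma : R -> C -> R,
    (forall m x, sigma (x + 4^-1 ^+ m) = sigma x) /\
    (forall g, exists x, sigma x = g).
Proof.
pose sigma (x : R) : C -> R :=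
  xget (fun=> 0) [set g | countable_code g = tail_code x].
exists sigma; split=> [m x|g]; first by rewrite /sigma tail_codeD.
have [x code_x] := tail_code_surj (countable_code g).
exists x; apply: countable_code_inj; rewrite -code_x.
by apply: (@xgetPex _ (fun=> 0) [set h |
  countable_code h = tail_code x]); exists g.
Qed.
End TailCode.

(** * Independent families *)

Section Interpolation.
Variable R : realType.

(** A strong form of algebraic independence, which is kept when all members are
    precomposed with the same surjection. *)
Definition interpolating (T : Type) (F : set R -> T -> R) : Prop :=
  forall (k : nat) (A : 'I_k -> set R) (r : 'I_k -> R), injective A ->
    exists t, forall i, F (A i) t = r i.

(** An argument g stands for a number of points ([g None], truncated), the
    points themselves (g at the naturals), and a value for each finite bit
    sequence. The function of A returns the value of the trace of A, i.e. of
    the membership bits of the points in A. All the data are put into one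
    function on a countable type so that [invariant_surjection] applies. *)
Definition trace_function (A : set R) (g : option (nat + seq bool) -> R) : R :=
  g (Some (inr [seq `[< A (g (Some (inl i))) >] |
                i <- iota 0 (Num.truncn (g None))])).

(** One point from the symmetric difference of each pair is enough. *)
Lemma separating_points (k : nat) (A : 'I_k -> set R) : injective A ->
  exists s : seq R, injective (fun i => [seq `[< A i x >] | x <- s]).
Proof.
move=> A_inj.
have [p sep_p] : exists p : 'I_k * 'I_k -> R, forall i j,
    (`[< A i (p (i, j)) >] = `[< A j (p (i, j)) >]) -> i = j.
  suff /choice[p sep_p] : forall ij : 'I_k * 'I_k, exists x,
      `[< A ij.1 x >] = `[< A ij.2 x >] -> ij.1 = ij.2.
    by exists p => i j; exact: (sep_p (i, j)).
  move=> [i j] /=; apply: contrapT => /forallNP no_sep.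
  apply: (no_sep 0) => _; apply: A_inj; apply/funext => x; apply/propext.
  by apply: asbool_eq_equiv; apply: contrapT => neq; apply: (no_sep x).
exists [seq p ij | ij <- enum {: 'I_k * 'I_k}] => i j.
move=> eq_ij; apply: sep_p; move: eq_ij.
rewrite -2!map_comp => /eq_in_map eq_ij.
exact: (eq_ij (i, j) (mem_enum predT (i, j))).
Qed.

Lemma trace_function_interpolating : interpolating trace_function.
Proof.
move=> k A r /separating_points[s s_sep].
pose value (t : seq bool) : R :=
  if [pick i | [seq `[< A i x >] | x <- s] == t] is Some i then r i else 0.
pose g (c : option (nat + seq bool)) : R :=
  match c with
  | None => (size s)%:R
  | Some (inl i) => s`_i
  | Some (inr t) => value t
  end.
exists g => i; rewrite /trace_function /= natrK.
rewrite [X in value X](_ : _ = [seq `[< A i x >] | x <- s]).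
  rewrite /value; case: pickP => [j /eqP /s_sep -> //|/(_ i)].
  by rewrite eqxx.
rewrite -[in RHS](mkseq_nth 0 s) /mkseq -map_comp.
by apply: eq_map => j.
Qed.

Lemma mmap_fctE (T : pointedType) (k : nat) (P : mpoly k R)
    (y : 'I_k -> T -> R) (t : T) :
  mmap (GRing.in_alg (T -> R)) y P t = meval (fun i => y i t) P.
Proof.
rewrite mevalE /mmap fct_sumE; apply: eq_bigr => m _.
rewrite mulrfctE /mmap1 fct_prodE; congr (_ * _).
  by rewrite /GRing.in_alg /= scalrfctE /GRing.scale /= mulr1.
by apply: eq_bigr => i _; rewrite exprfctE.
Qed.

(** Interpolation alone makes the range of F a set of 2 ^ c free generators, so
    that it is left to see that what they generate lies in S. *)
Lemma interpolating_algebrable (T : pointedType) (F : set R -> T -> R)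
    (S : set (T -> R)) :
  interpolating F ->
  (forall (k : nat) (P : mpoly k R) (A : 'I_k -> set R),
     P != 0 -> mcoeff mnm0 P = 0 -> injective A ->
     S (mmap (GRing.in_alg (T -> R)) (F \o A) P)) ->
  strongly_algebrable R (T -> R) [set: set R] S.
Proof.
move=> F_interp S_mmap.
have F_inj : injective F.
  move=> A B eq_AB; apply: contrapT => neq_AB.
  (* If A and B differ, then F A and F B take the values 1 and 0 somewhere. *)
  pose AB (i : 'I_2) := if i == ord0 then A else B.
  have AB_inj : injective AB.
    move=> i j; rewrite /AB.
    case: ifPn => [/eqP->|i_neq0]; case: ifPn => [/eqP->|j_neq0] //.
    - by move=> /esym.
    - move=> _; apply: val_inj; move: i j i_neq0 j_neq0.
      by move=> [[|[|//]] ?] [[|[|//]] ?].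
  have [t Ft] := F_interp _ AB (fun i => (i == ord0)%:R) AB_inj.
  have /eqP := Ft (lift ord0 ord0); rewrite /AB /= -eq_AB (Ft ord0).
  by rewrite /= oner_eq0.
exists (range F); split; first by apply: inj_card_eq => A B _ _; exact: F_inj.
move=> k P y P_neq0 P_0 y_inj range_y.
have /choice[A F_A] : forall i, exists A, F A = y i.
  by move=> i; have [A _ FA] := range_y i; exists A.
have A_inj : injective A by move=> i j eq_ij; apply: y_inj; rewrite -!F_A eq_ij.
have -> : y = F \o A by apply/funext => i; rewrite /= F_A.
split; last exact: S_mmap.
have [r P_r] := mpoly_nonvanishing P_neq0.
have [t Ft] := F_interp _ _ r A_inj.
apply/eqP => /(congr1 (fun f => f t)); rewrite mmap_fctE.
have -> : (fun i => (F \o A) i t) = r by apply/funext.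
exact/eqP.
Qed.
End Interpolation.

(** * Feeble continuity of translation-invariant functions *)

Section FeebleFamilies.
Variable R : realType.

Lemma decreases_to_shift (x : R) : decreases_to (fun n => x + 4^-1 ^+ n) x.
Proof.
have q_gt0 : 0 < 4^-1 :> R by rewrite invr_gt0.
have q_lt1 : 4^-1 < 1 :> R by rewrite invf_lt1 ?ltr1n.
split; first by move=> m n; rewrite lerD2l; exact: ler_iXn2l.
rewrite -[X in _ --> X]addr0; apply: cvgD; first exact: cvg_cst.
rewrite [X in X @ _](_ : _ = geometric 1 4^-1).
  by apply: cvg_geometric; rewrite gtr0_norm.
by apply: funext => n; rewrite /= mul1r.
Qed.

Lemma decreases_to_gt (u : nat -> R) (x : R) :
  decreases_to u x -> forall n, x < u n.
Proof.
move=> [u_decr u_x] n.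
apply: (@le_lt_trans _ _ (u n.+1)); last by rewrite ltNge u_decr ltnn.
have /= := @nonincreasing_cvgn_ge R u.
rewrite -(cvg_lim _ u_x) //; apply.
  by move=> i j le_ij; rewrite u_decr.
exact: cvgP u_x.
Qed.

Lemma FC_of_shift (f : R * R -> R) :
  (forall n x y z, f (x + 4^-1 ^+ n, z) = f (x, y)) -> FC R f.
Proof.
move=> f_shift x y; exists (fun n => x + 4^-1 ^+ n), (fun n => y + 4^-1 ^+ n).
do 2 (split; first exact: decreases_to_shift).
exists (fun=> f (x, y)); split=> [n|]; last exact: cvg_cst.
by apply: cvg_near_cst; apply: nearW => m; rewrite (f_shift _ _ y).
Qed.

Lemma TFC_of_shift (f : R * R -> R) :
  (forall n x y, f (x + 4^-1 ^+ n, y + 4^-1 ^+ n) = f (x, y)) -> TFC R f.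
Proof.
move=> f_shift x y; exists (fun n => x + 4^-1 ^+ n), (fun n => y + 4^-1 ^+ n).
do 2 (split; first exact: decreases_to_shift).
by apply: cvg_near_cst; apply: nearW => n; rewrite f_shift.
Qed.

(** Iterated limits at (a, a) only see points off the diagonal: the first
    coordinate stays fixed above a while the second one decreases to a. *)
Lemma not_VFC_of_diagonal (f : R * R -> R) (a : R) :
  (forall x y, x != y -> f (x, y) = 0) -> f (a, a) != 0 -> ~ VFC R f.
Proof.
move=> f0 f_aa /(_ a a) [u [v [u_a [v_a [g [f_g g_f]]]]]].
have g0 n : g n = 0.
  apply: cvg_unique (f_g n) _ => //; apply: cvg_near_cst.
  have lt_au := decreases_to_gt u_a n.
  have : \forall m \near \oo, v n m < u n.
    by apply: (cvgr_lt a) => //; case: (v_a n).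
  by apply: filterS => m lt_vu; rewrite f0 // gt_eqF.
case/eqP: f_aa; apply: cvg_unique g_f _ => //.
by apply: cvg_near_cst; apply: nearW => n; rewrite g0.
Qed.

End FeebleFamilies.

(** * The two families of generators *)

(* [set: set R] has cardinality 2 ^ c. *)
Theorem theorem15 (R : realType) :
  strongly_algebrable R (R * R -> R)%type [set: set R] (FC R) /\
  strongly_algebrable R (R * R -> R)%type [set: set R] (TFC R `\` VFC R).
Proof.
have [sigma [sigma_shift sigma_surj]] :=
  invariant_surjection R (option (nat + seq bool)).
pose h A x := trace_function A (sigma x).
have h_interp : interpolating h.
  move=> k A r /(trace_function_interpolating r)[g g_r].
  by have [x sigma_x] := sigma_surj g; exists x => i; rewrite /h sigma_x.
have h_shift A x n : h A (x + 4^-1 ^+ n) = h A x by rewrite /h sigma_shift.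
split.
  apply: (@interpolating_algebrable R (R * R)%type (fun A p => h A p.1)).
    move=> k A r /(h_interp _ _ r)[x h_r]; exists (x, 0); exact: h_r.
  move=> k P A _ _ _; apply: FC_of_shift => n x y z; rewrite !mmap_fctE /=.
  by congr (meval _ P); apply/funext => i; rewrite h_shift.
pose F A (p : R * R) := if p.1 == p.2 then h A p.1 else 0.
have F_diag A x : F A (x, x) = h A x by rewrite /F eqxx.
apply: (@interpolating_algebrable R (R * R)%type F).
  move=> k A r /(h_interp _ _ r)[x h_r]; exists (x, x) => i.
  by rewrite F_diag h_r.
move=> k P A P_neq0 P_0 A_inj; split.
  apply: TFC_of_shift => n x y; rewrite !mmap_fctE /=.
  congr (meval _ P); apply/funext => i.
  by rewrite /F /= (inj_eq (addIr _)) h_shift.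
have [r P_r] := mpoly_nonvanishing P_neq0.
have [a h_r] := h_interp _ _ r A_inj.
apply: (@not_VFC_of_diagonal R _ a) => [x y neq_xy|]; rewrite mmap_fctE /=.
  rewrite -[RHS]P_0 -meval_origin; congr (meval _ P); apply/funext => i.
  by rewrite /F /= (negPf neq_xy).
suff -> : (fun i => F (A i) (a, a)) = r by [].
by apply/funext => i; rewrite F_diag h_r.
Qed.
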